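(* Let $J\subseteq\mathbb K[x_1,\dots,x_n]$ be a $\mathbf d$-homogeneous ideal ($\mathbf d\in\mathbb Z^n_{>0}$), $C$ a maximal cone of its Gröbner fan, $<$ a monomial term order compatible with $C$ and $\mathcal G$ the reduced Gröbner basis of $J$ with respect to $<$. The set $\tilde{\mathcal G}=\{\tilde g:g\in\mathcal G\}$ is a Gröbner basis for the lifted ideal $\tilde J$ with respect to $\ll$. In particular, $\tilde{\mathcal G}$ is a generating set for $\tilde J$.
   Context: $\mathbb K$ is an algebraically closed field. $J$ is $\mathbf d$-homogeneous if generated by homogeneous elements for $\deg x_i=d_i$. For $w\in\mathbb R^n$, $\operatorname{in}_w(f)$ is the sum of terms $c_\alpha\mathbf x^\alpha$ of $f$ with $w\cdot\alpha$ minimal, $\operatorname{in}_w(J)=\langle\operatorname{in}_w(f):f\in J\rangle$; for a monomial term order $<$, $\operatorname{in}_<(f)$ is the $<$-largest term. The Gröbner fan is the complete fan in $\mathbb R^n$ in which $u,w$ lie in the relative interior of the same cone iff $\operatorname{in}_u(J)=\operatorname{in}_w(J)$; maximal cones are $n$-dimensional; $<$ is compatible with $C$ if $\operatorname{in}_<(J)=\operatorname{in}_w(J)$ for $w\in C^\circ$. $\mathcal L(J)=\{u:\operatorname{in}_u(J)=J\}$, $\overline C=C/\mathcal L(J)$. Fix $r_1,\dots,r_m\in C\cap\mathbb Z^n$ representing the primitive ray generators of $\overline C\subset\mathbb R^n/\mathcal L(J)$ and let $\mathbf r$ be the matrix with rows $r_i$. For $0\ne f=\sum c_\alpha\mathbf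 x^\alpha\in J$ let $\mu(f)=(\min_{c_\alpha\ne0}r_i\cdot\alpha)_i\in\mathbb Z^m$ and $\tilde f=\sum c_\alpha\mathbf x^\alpha\mathbf t^{\mathbf r\cdot\alpha-\mu(f)}\in\mathbb K[t_1,\dots,t_m][x_1,\dots,x_n]$; $\tilde J=\langle\tilde f:f\in J\rangle$. The monomial term order $\ll$ on $\mathbb K[t_1,\dots,t_m,x_1,\dots,x_n]$ extends $<$: $t_i\ll x_j$ for all $i,j$, and $\mathbf x^\alpha\mathbf t^\lambda\ll\mathbf x^\beta\mathbf t^\nu$ iff either $\mathbf x^\alpha<\mathbf x^\beta$, or $\mathbf x^\alpha=\mathbf x^\beta$ and $\mathbf t^\lambda<_{\rm lex}\mathbf t^\nu$. *)

(* Defs.v *)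
From HB Require Import structures.
From mathcomp Require Import all_boot all_order all_algebra.
From mathcomp Require Import classical_sets cardinality reals.
From mathcomp Require Import mpoly.

Set Implicit Arguments.
Unset Strict Implicit.
Unset Printing Implicit Defensive.

Import Order.TTheory GRing.Theory Num.Theory.
Local Open Scope classical_set_scope.
Local Open Scope ring_scope.

Section Ideals.
Context {A : comNzRingType}.

Definition ideal_gen (S : set A) : set A :=
  [set f | exists (k : nat) (c g : 'I_k -> A),
     (forall i, S (g i)) /\ f = \sum_(i < k) c i * g i].

End Ideals.

Definition wdeg {R : pzRingType} {n : nat} (w : 'rV[R]_n) (a : 'X_{1..n}) : R :=
  \sum_(i < n) w 0 i *+ a i.

Section InitialForms.
Context {K : fieldType} {R : realType} {n : nat}.
Implicit Types (f : {mpoly K[n]}) (J : set {mpoly K[n]}).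

Definition homogeneous (d : 'rV[int]_n) f : Prop :=
  {in msupp f &, forall a b, wdeg d a = wdeg d b}.

Definition homogeneous_ideal (d : 'rV[int]_n) J : Prop :=
  exists2 S : set {mpoly K[n]},
    (forall f, S f -> homogeneous d f) & J = ideal_gen S.

(* Minimum convention: the terms of least w-weight are kept. *)
Definition in_w (w : 'rV[R]_n) f : {mpoly K[n]} :=
  \sum_(a <- msupp f | all (fun b => wdeg w a <= wdeg w b) (msupp f))
     f@_a *: 'X_[a].

Definition in_w_ideal (w : 'rV[R]_n) J : set {mpoly K[n]} :=
  ideal_gen [set in_w w f | f in J].

Definition lineality J : set 'rV[R]_n := [set u | in_w_ideal u J = J].

End InitialForms.

(* [lt] is the strict order; multinomials' own [mlead] is tied to one fixed
   monomial order and so is not used. *)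
Definition term_order {n : nat} (lt : rel 'X_{1..n}) : Prop :=
  [/\ irreflexive lt,
      transitive lt,
      forall a b, a != b -> lt a b || lt b a,
      forall a b c, lt a b -> lt (a + c)%MM (b + c)%MM
    & forall a, a != 0%MM -> lt 0%MM a].

Section GroebnerBases.
Context {K : fieldType} {n : nat}.
Variable lt : rel 'X_{1..n}.
Implicit Types (f : {mpoly K[n]}) (J : set {mpoly K[n]}) (G : seq {mpoly K[n]}).

Definition in_lt f : {mpoly K[n]} :=
  \sum_(a <- msupp f | all (fun b => (b == a) || lt b a) (msupp f))
     f@_a *: 'X_[a].

Definition in_lt_ideal J : set {mpoly K[n]} := ideal_gen [set in_lt f | f in J].

Definition groebner_basis J G : Prop :=
  (forall g, g \in G -> J g) /\
  ideal_gen [set in_lt g | g in [set` G]] = in_lt_ideal J.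

(* The first condition says that every g in G is nonzero with leading
   coefficient 1. *)
Definition reduced_groebner_basis J G : Prop :=
  [/\ groebner_basis J G,
      forall g, g \in G -> exists a : 'X_{1..n}, in_lt g = 'X_[a]
    & forall g a, g \in G -> a \in msupp g ->
        ~ ideal_gen [set in_lt h | h in [set h | h \in G /\ h != g]] 'X_[a]].

End GroebnerBases.

Section Cones.
Context {R : realType} {n : nat}.
Implicit Types (C F : set 'rV[R]_n) (Sigma : set (set 'rV[R]_n)).

Definition polyhedral_cone C : Prop :=
  exists (k : nat) (A : 'M[R]_(n, k)),
    C = [set u | forall j, 0 <= (u *m A) 0 j].

Definition face F C : Prop :=
  exists l : 'cV[R]_n,
    (forall u, C u -> 0 <= (u *m l) 0 0) /\
    F = [set u | C u /\ (u *m l) 0 0 = 0].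

Definition lin_span C : set 'rV[R]_n :=
  [set u | exists (k : nat) (B : 'M[R]_(k, n)),
     (forall i, C (row i B)) /\ (u <= B)%MS].

Definition cone_dim C (d : nat) : Prop :=
  exists2 B : 'M[R]_(d, n), row_free B &
    forall u, lin_span C u <-> (u <= B)%MS.

(* Interior relative to the affine hull, which for a cone is the linear span. *)
Definition relint C : set 'rV[R]_n :=
  [set u | C u /\ exists2 e : R, 0 < e &
     forall v, lin_span C v -> (forall i, `|v 0 i - u 0 i| < e) -> C v].

Definition complete_fan Sigma : Prop :=
  [/\ finite_set Sigma,
      forall C, Sigma C -> polyhedral_cone C,
      forall C F, Sigma C -> face F C -> Sigma F,
      forall C D, Sigma C -> Sigma D -> face (C `&` D) C /\ face (C `&` D) D
    & forall u, exists2 C, Sigma C & C u].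

End Cones.

Section GroebnerFan.
Context {K : fieldType} {R : realType} {n : nat}.
Implicit Types (J : set {mpoly K[n]}) (C : set 'rV[R]_n).

Definition groebner_fan J (Sigma : set (set 'rV[R]_n)) : Prop :=
  complete_fan Sigma /\
  forall u w : 'rV[R]_n,
    (exists C, [/\ Sigma C, relint C u & relint C w]) <->
    in_w_ideal u J = in_w_ideal w J.

Definition maximal_cone (Sigma : set (set 'rV[R]_n)) C : Prop :=
  Sigma C /\ cone_dim C n.

Definition compatible J (lt : rel 'X_{1..n}) C : Prop :=
  forall w, relint C w -> in_lt_ideal lt J = in_w_ideal w J.

End GroebnerFan.

Section RayGenerators.
Context {R : realType} {n : nat}.

(* [pi], acting on row vectors by right multiplication, presents R^k as the
   quotient R^n / L. *)
Definition quotient_map (L : set 'rV[R]_n) {k : nat} (pi : 'M[R]_(n, k)) : Prop :=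
  row_full pi /\ L = [set u | u *m pi = 0].

Definition ray {k : nat} (rho D : set 'rV[R]_k) : Prop :=
  face rho D /\ cone_dim rho 1.

(* The image of Z^n in R^n / L. *)
Definition lattice {k : nat} (pi : 'M[R]_(n, k)) : set 'rV[R]_k :=
  [set map_mx intr z *m pi | z in [set: 'rV[int]_n]].

(* [v] is the nonzero element generating the monoid of lattice points of the
   ray [rho]. *)
Definition primitive_generator {k : nat} (pi : 'M[R]_(n, k))
    (rho : set 'rV[R]_k) (v : 'rV[R]_k) : Prop :=
  [/\ v != 0, rho v, lattice pi v
    & forall u, rho u -> lattice pi u -> exists q : nat, u = v *+ q].

(* The rows of [r] are integral points of C whose classes modulo L are the
   primitive ray generators of C / L, each represented exactly once. The
   condition does not depend on the chosen presentation of R^n / L. *)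
Definition represent_rays (L C : set 'rV[R]_n) {m : nat} (r : 'M[int]_(m, n)) : Prop :=
  let rr (i : 'I_m) : 'rV[R]_n := map_mx intr (row i r) in
  (forall i, C (rr i)) /\
  exists (k : nat) (pi : 'M[R]_(n, k)),
    let Cbar : set 'rV[R]_k := [set u *m pi | u in C] in
    [/\ quotient_map L pi,
        forall i, exists2 rho, ray rho Cbar & primitive_generator pi rho (rr i *m pi)
      & forall rho, ray rho Cbar ->
          exists! i : 'I_m, primitive_generator pi rho (rr i *m pi)].

End RayGenerators.

(* K[t_1..t_m][x_1..x_n] is represented as {mpoly K[m + n]}: the index
   [lshift n i] stands for t_i and [rshift m j] for x_j. *)
Section Lift.
Context {m n : nat}.

Definition mnm_xt (a : 'X_{1..n}) (l : 'X_{1..m}) : 'X_{1..(m + n)} :=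
  [multinom match split k with inl i => l i | inr j => a j end | k < m + n].

Definition xpart (c : 'X_{1..(m + n)}) : 'X_{1..n} :=
  [multinom c (rshift m j) | j < n].

Definition tpart (c : 'X_{1..(m + n)}) : 'X_{1..m} :=
  [multinom c (lshift n i) | i < m].

Definition lex_lt (l v : 'X_{1..m}) : bool :=
  [exists i : 'I_m, (l i < v i)%N &&
     [forall j : 'I_m, (j < i)%N ==> (l j == v j)]].

Definition ll (lt : rel 'X_{1..n}) : rel 'X_{1..(m + n)} := fun c e =>
  lt (xpart c) (xpart e) ||
  ((xpart c == xpart e) && lex_lt (tpart c) (tpart e)).

Context {K : fieldType}.
Variable r : 'M[int]_(m, n).

(* For f != 0 the base point of the minimum is attained on the support. *)
Definition mu (f : {mpoly K[n]}) (i : 'I_m) : int :=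
  \big[Order.min/wdeg (row i r) (head 0%MM (msupp f))]_(a <- msupp f)
     wdeg (row i r) a.

(* The difference is nonnegative for [a] in the support of f. *)
Definition t_exponent (f : {mpoly K[n]}) (a : 'X_{1..n}) : 'X_{1..m} :=
  [multinom `|wdeg (row i r) a - mu f i|%N | i < m].

Definition lift_poly (f : {mpoly K[n]}) : {mpoly K[m + n]} :=
  \sum_(a <- msupp f) f@_a *: 'X_[mnm_xt a (t_exponent f a)].

Definition lifted_ideal (J : set {mpoly K[n]}) : set {mpoly K[m + n]} :=
  ideal_gen [set lift_poly f | f in [set f | J f /\ f != 0]].

End Lift.

Lemma lex_ltP (m : nat) (l v : 'X_{1..m}) :
  reflect (exists i : 'I_m, (l i < v i)%N /\ forall j : 'I_m, (j < i)%N -> l j = v j)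
          (lex_lt l v).
Proof.
apply: (iffP existsP) => [[i /andP[hi /forallP H]]|[i [hi H]]]; exists i.
  by split=> // j ji; apply/eqP/(implyP (H j)).
by rewrite hi; apply/forallP => j; apply/implyP => /H ->.
Qed.

Lemma lex_lt_total (m : nat) (l v : 'X_{1..m}) :
  l != v -> lex_lt l v || lex_lt v l.
Proof.
move=> ne.
have [i0 Hi0]: exists i : 'I_m, l i != v i.
  apply/existsP; rewrite -negb_forall; apply: contra ne => /forallP H.
  by apply/eqP/mnmP => i; apply/eqP/H.
case: (@arg_minnP _ i0 (fun i => l i != v i) val Hi0) => i Hi Hmin.
have eqj (j : 'I_m) : (j < i)%N -> l j == v j.
  by move=> ji; apply/negP => /negP /Hmin; rewrite leqNgt ji.
case: (ltngtP (l i) (v i)) Hi => // H _; apply/orP; [left|right].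
  by apply/lex_ltP; exists i; split=> // j /eqj /eqP.
by apply/lex_ltP; exists i; split=> // j /eqj /eqP.
Qed.

Lemma ll_term_order (m n : nat) (lt : rel 'X_{1..n}) :
  term_order lt -> term_order (@ll m n lt).
Proof.
move=> [irr tr tot add pos].
have xD (a b : 'X_{1..(m + n)}) : xpart (a + b)%MM = (xpart a + xpart b)%MM.
  by apply/mnmP => i; rewrite !(mnmE, mnmDE).
have tD (a b : 'X_{1..(m + n)}) : tpart (a + b)%MM = (tpart a + tpart b)%MM.
  by apply/mnmP => i; rewrite !(mnmE, mnmDE).
have ext (a b : 'X_{1..(m + n)}) : xpart a = xpart b -> tpart a = tpart b -> a = b.
  move=> /mnmP hx /mnmP ht; apply/mnmP => k; rewrite -(splitK k).
  by case: (split k) => j /=; [have := ht j | have := hx j]; rewrite !mnmE.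
have tot' (a b : 'X_{1..(m + n)}) : a != b -> ll lt a b || ll lt b a.
  move=> ne; rewrite /ll; case: (eqVneq (xpart a) (xpart b)) => [e|nex].
    rewrite e irr /=; apply: lex_lt_total.
    by apply: contra ne => /eqP et; apply/eqP/ext.
  by case/orP: (tot _ _ nex) => ->; rewrite ?orbT.
split=> //.
- move=> a; rewrite /ll irr eqxx /=; apply/negbTE/negP => /lex_ltP[i []].
  by rewrite ltnn.
- move=> b a c; rewrite /ll => /orP[ab|/andP[/eqP eab lab]] /orP[bc|/andP[/eqP ebc lbc]].
  + by rewrite (tr _ _ _ ab bc).
  + by rewrite -ebc ab.
  + by rewrite eab bc.
  + apply/orP; right; rewrite eab ebc eqxx /=.
    case/lex_ltP: lab => i [hi Hi]; case/lex_ltP: lbc => j [hj Hj].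
    apply/lex_ltP; case: (ltngtP i j) => ij.
    * exists i; rewrite -(Hj i ij); split=> // k ki.
      by rewrite (Hi k ki) (Hj k (ltn_trans ki ij)).
    * exists j; rewrite (Hi j ij); split=> // k kj.
      by rewrite (Hi k (ltn_trans kj ij)) (Hj k kj).
    * have e : i = j by apply: val_inj.
      subst j; exists i; rewrite (ltn_trans hi hj); split=> // k ki.
      by rewrite (Hi k ki) (Hj k ki).
- move=> a b c; rewrite /ll !xD !tD => /orP[/add ->//|/andP[/eqP -> /lex_ltP[i [hi Hi]]]].
  apply/orP; right; rewrite eqxx /=; apply/lex_ltP; exists i.
  by rewrite !mnmDE ltn_add2r hi; split=> // j /Hi; rewrite !mnmDE => ->.
- move=> a a0; have x0 : xpart (0 : 'X_{1..(m + n)})%MM = 0%MM.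
    by apply/mnmP => i; rewrite mnmE !mnm0E.
  have t0 : tpart (0 : 'X_{1..(m + n)})%MM = 0%MM.
    by apply/mnmP => i; rewrite mnmE !mnm0E.
  rewrite eq_sym in a0; case/orP: (tot' _ _ a0) => //; rewrite /ll x0 t0.
  case: (eqVneq (xpart a) 0%MM) => [->|nx].
    by rewrite irr /= => /lex_ltP[i []]; rewrite mnm0E.
  by rewrite (pos _ nx).
Qed.

(* t_i << x_j for all i and j. *)
Lemma ll_tx (m n : nat) (lt : rel 'X_{1..n}) (i : 'I_m) (j : 'I_n) :
  term_order lt -> ll lt U_(lshift n i)%MM U_(rshift m j)%MM.
Proof.
move=> [_ _ _ _ pos]; rewrite /ll.
have -> : xpart U_(lshift n i)%MM = 0%MM.
  by apply/mnmP => k; rewrite mnmE mnm1E mnm0E eq_lrshift.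
rewrite pos //; apply/negP => /eqP /mnmP /(_ j).
by rewrite mnmE mnm1E mnm0E eqxx.
Qed.

(* Main.v *)
Require Import Defs.
From HB Require Import structures.
From mathcomp Require Import all_boot all_order all_algebra.
From mathcomp Require Import boolp classical_sets cardinality reals.
From mathcomp Require Import lra.
From mathcomp Require Import mpoly.

Import Order.TTheory GRing.Theory Num.Theory.
Local Open Scope ring_scope.

(** The lifted basis keeps its leading monomials.  Let g be in G with leading
    exponent a.  For a weight w interior to C, in_w(g) lies in the initial ideal
    of J for <, which is a monomial ideal; since G is reduced, a is the only
    exponent of g lying in that ideal, so a has least w-weight on the support
    of g.  Moving w towards a point of C, the inequality survives
    ([lead_min_weight_cone]); in particular it holds for every row r_i of r.
    Hence mu(g)_i = r_i . a, no power of t is attached to x^a in the lift of g,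
    and the leading monomial of that lift for << is x^a itself.

    The leading monomials of the lifted ideal come from J.  Give x^b t^l the
    degree r . b - l in Z^m.  The lift of f is homogeneous of degree mu(f), so the
    lifted ideal is graded, and setting t = 1 in the homogeneous component of
    degree delta of an element h of the lifted ideal gives an element of J, called
    [slice delta h] below ([slice_lifted_ideal]).  In a fixed degree the exponent
    of x determines that of t, so nothing cancels: if x^b t^l is the leading
    monomial of h and delta its degree, x^b is the leading monomial of the slice
    ([lead_exponent_slice]).  As G is a Groebner basis of J, x^b is divisible by the
    leading monomial x^a of some g in G, which is also that of the lift of g.

    Both conclusions follow from this divisibility by [groebner_criterion]: it gives
    the equality of initial ideals at once, and generation through the division
    algorithm, which terminates because term orders are well founded
    ([term_order_wf], from Dickson's lemma). *)

Set Implicit Arguments.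
Unset Strict Implicit.

(** * Ideals *)
Section GeneratedIdeals.
Context {A : comNzRingType}.
Implicit Types (S I : set A) (f g : A).

Definition is_ideal I : Prop :=
  [/\ I 0, forall f g, I f -> I g -> I (f + g) & forall c f, I f -> I (c * f)].

Lemma is_ideal_sum I (T : Type) (s : seq T) (P : pred T) (F : T -> A) :
  is_ideal I -> (forall i, P i -> I (F i)) -> I (\sum_(i <- s | P i) F i).
Proof. by case=> I0 ID _ IF; apply: (big_ind I). Qed.

Lemma mem_ideal_gen S f : S f -> ideal_gen S f.
Proof.
by move=> Sf; exists 1, (fun _ => 1), (fun _ => f); rewrite big_ord1 mul1r.
Qed.

Lemma ideal_gen_is_ideal S : is_ideal (ideal_gen S).
Proof.
split.
- by exists 0, (fun _ => 0), (fun _ => 0); rewrite big_ord0; split=> [[]|].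
- move=> _ _ [k [c [g [Sg ->]]]] [l [c' [g' [Sg' ->]]]].
  exists (k + l), (fun i => match split i with inl j => c j | inr j => c' j end).
  exists (fun i => match split i with inl j => g j | inr j => g' j end).
  split; first by move=> i; case: (split i).
  rewrite big_split_ord /=; congr (_ + _); apply: eq_bigr => i _.
    by rewrite (unsplitK (inl i)).
  by rewrite (unsplitK (inr i)).
- move=> c _ [k [c' [g [Sg ->]]]]; exists k, (fun i => c * c' i), g.
  by split=> //; rewrite mulr_sumr; apply: eq_bigr => i _; rewrite mulrA.
Qed.

Lemma ideal_gen_min S I : is_ideal I -> (forall f, S f -> I f) ->
  forall f, ideal_gen S f -> I f.
Proof.
move=> idI SI _ [k [c [g [Sg ->]]]]; apply: is_ideal_sum => // i _.
by case: idI => _ _; apply; apply/SI/Sg.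
Qed.

End GeneratedIdeals.

(** * Dickson's lemma *)
Section Dickson.

(** Take an index where u is least, then one where u is least among the later
    indices, and so on: the values met this way cannot decrease. *)
Lemma nondecreasing_subsequence (u : nat -> nat) :
  exists2 g : nat -> nat, {homo g : i j / (i < j)%N} &
    {homo u \o g : i j / (i <= j)%N}.
Proof.
have min_after p : exists q, (p <= q)%N /\ forall q', (p <= q')%N -> (u q <= u q')%N.
  have ex_val : exists v, `[< exists2 q, (p <= q)%N & u q = v >].
    by exists (u p); apply/asboolP; exists p.
  case: (ex_minnP ex_val) => _ /asboolP[q pq <-] qmin.
  by exists q; split=> // q' pq'; apply: qmin; apply/asboolP; exists q'.
have [a a_spec] := choice min_after.
pose g k := iter k (fun q => a q.+1) (a 0%N).
have g_lt k : (g k < g k.+1)%N by have [] := a_spec (g k).+1.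
have g_min k : exists2 p, (p <= g k)%N & g k = a p.
  by case: k => [|k]; [exists 0%N | exists (g k).+1 => //; apply: g_lt].
exists g; first exact: (homo_ltn ltn_trans).
apply: (homo_leq leqnn leq_trans) => k; have [p pg gk] := g_min k.
have pg1 : (p <= g k.+1)%N by apply: leq_trans pg (ltnW (g_lt k)).
by rewrite [_ k]/= gk; have [_] := a_spec p; apply.
Qed.

(** Extract, one coordinate after the other, a subsequence nondecreasing in all
    coordinates; its first two terms are comparable for divisibility. *)
Lemma dickson n (s : nat -> 'X_{1..n}) : exists i j, (i < j)%N /\ (s i <= s j)%MM.
Proof.
have [g g_lt s_le] : exists2 g : nat -> nat, {homo g : i j / (i < j)%N} &
    forall k, k \in enum 'I_n -> {homo (fun i => s (g i) k) : i j / (i <= j)%N}.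
  elim: (enum 'I_n) => [|k ks [g g_lt s_le]]; first by exists id.
  have [h h_lt sk_le] := nondecreasing_subsequence (fun i => s (g i) k).
  have h_le : {homo h : i j / (i <= j)%N} by apply: ltnW_homo.
  exists (g \o h); first by move=> i j ij; apply/g_lt/h_lt.
  move=> l; rewrite inE => /orP[/eqP ->|l_ks] i j ij; first exact: sk_le.
  exact/(s_le l l_ks)/h_le.
exists (g 0%N), (g 1%N); split; first exact: g_lt.
by apply/mnm_lepP => k; apply: (s_le k) => //; rewrite mem_enum.
Qed.

End Dickson.

(** * Well-foundedness of term orders *)
Section TermOrders.
Context {n : nat} {lt : rel 'X_{1..n}}.
Hypothesis lt_order : term_order lt.

Lemma term_order_le_trans a b c :
  (a == b) || lt a b -> lt b c -> lt a c.
Proof.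
case: lt_order => _ tr _ _ _ /orP[/eqP -> //|ab bc].
exact: tr ab bc.
Qed.

Lemma term_order_antisym a b : lt a b -> lt b a -> False.
Proof.
case: lt_order => irr tr _ _ _ ab ba.
by have := tr _ _ _ ab ba; rewrite irr.
Qed.

Lemma term_order_divides a b : (a <= b)%MM -> (a == b) || lt a b.
Proof.
case: lt_order => _ _ _ add pos ab; rewrite -(submK ab).
have [-> |nz] := eqVneq (b - a)%MM 0%MM; first by rewrite add0m eqxx.
by have := add _ _ a (pos _ nz); rewrite add0m => ->; rewrite orbT.
Qed.

(** An infinite descending sequence would, by Dickson's lemma, contain a monomial
    dividing a later one, whereas divisors are smaller in any term order. *)
Lemma term_order_wf : well_founded (fun a b => lt a b).
Proof.
move=> a0; apply: contrapT => na0.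
have step (x : {a | ~ Acc (fun a b => lt a b) a}) :
    exists y : {a | ~ Acc (fun a b => lt a b) a}, lt (sval y) (sval x).
  case: x => x nx /=; apply: contrapT => none; apply: nx; constructor => y yx.
  by apply: contrapT => ny; apply: none; exists (exist _ y ny).
have [next next_lt] := choice step.
pose s k := sval (iter k next (exist _ a0 na0)).
have s_desc : {homo s : i j / (i < j)%N >-> lt j i}.
  apply: homo_ltn => [y x z xy yz|k]; last exact: next_lt.
  by case: lt_order => _ tr _ _ _; apply: tr yz xy.
have [i [j [ij s_le]]] := dickson s.
case/orP: (term_order_divides s_le) => [/eqP e|]; last first.
  by move/term_order_antisym; apply; apply: s_desc.
by have := s_desc _ _ ij; rewrite e; case: lt_order => ->.
Qed.

End TermOrders.

(** * Leading exponents and a criterion for Groebner bases *)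
Definition lead_exponent (K : fieldType) n (lt : rel 'X_{1..n}) (f : {mpoly K[n]})
    (a : 'X_{1..n}) : bool :=
  (a \in msupp f) && all (fun b => (b == a) || lt b a) (msupp f).

Section LeadingExponents.
Context {K : fieldType} {n : nat} {lt : rel 'X_{1..n}}.
Hypothesis lt_order : term_order lt.
Implicit Types (f g h : {mpoly K[n]}) (I : set {mpoly K[n]}) (G : seq {mpoly K[n]}).

Lemma exists_lead_exponent f : f != 0 -> exists a, lead_exponent lt f a.
Proof.
rewrite -msupp_eq0 /lead_exponent; elim: (msupp f) => // a s IHs _.
have [-> | s_nil] := eqVneq s [::]; first by exists a; rewrite /= inE !eqxx.
have [b /andP[bs /allP b_max]] := IHs s_nil.
have [ab|nab] := boolP ((a == b) || lt a b).
  by exists b; rewrite inE bs orbT /= ab; apply/allP.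
exists a; rewrite inE eqxx /= eqxx /=; apply/allP => c cs; apply/orP; right.
apply: term_order_le_trans (b_max c cs) _ => //.
move: nab; rewrite negb_or => /andP[ne nlt].
by case: lt_order => _ _ tot _ _; have := tot _ _ ne; rewrite (negbTE nlt).
Qed.

Lemma lead_exponent_uniq f a b : lead_exponent lt f a -> lead_exponent lt f b -> a = b.
Proof.
move=> /andP[af /allP a_max] /andP[bf /allP b_max].
case/orP: (a_max b bf) => [/eqP //|ba]; case/orP: (b_max a af) => [/eqP //|ab].
by case: (term_order_antisym lt_order ab ba).
Qed.

Lemma lead_coeff_neq0 f a : lead_exponent lt f a -> f@_a != 0.
Proof. by case/andP; rewrite mcoeff_msupp. Qed.

Lemma in_lt_lead f a : lead_exponent lt f a -> in_lt lt f = f@_a *: 'X_[a].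
Proof.
move=> fa; have /andP[af a_max] := fa.
rewrite /in_lt -big_filter (_ : [seq _ <- _ | _] = [:: a]) ?big_seq1 //.
apply: perm_small_eq => //; apply: uniq_perm; rewrite ?filter_uniq ?msupp_uniq //.
move=> b; rewrite mem_filter inE; apply/andP/eqP => [[b_max bf]|->]; last by [].
by apply: lead_exponent_uniq fa; rewrite /lead_exponent bf.
Qed.

Lemma in_lt0 : in_lt lt (0 : {mpoly K[n]}) = 0.
Proof. by rewrite /in_lt -mpolyC0 msupp0 big_nil. Qed.

Lemma msupp_in_lt f a : a \in msupp (in_lt lt f) -> lead_exponent lt f a.
Proof.
have [->|/exists_lead_exponent[b fb]] := eqVneq f 0.
  by rewrite in_lt0 mcoeff_msupp mcoeff0 eqxx.
rewrite (in_lt_lead fb) msuppMCX ?lead_coeff_neq0 // inE => /eqP ->.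
exact: fb.
Qed.

Lemma msupp_mul_divides f g c : c \in msupp (f * g) -> exists2 b, b \in msupp g & (b <= c)%MM.
Proof.
move=> /msuppM_le /allpairsP[[a b] /= [_ bg ->]].
by exists b => //; apply: lem_addl.
Qed.

(** For any S this only bounds supports; for a set of monomials it is the
    membership test of monomial ideals. *)
Lemma msupp_ideal_gen (S : set {mpoly K[n]}) f b : ideal_gen S f -> b \in msupp f ->
  exists s a, [/\ S s, a \in msupp s & (a <= b)%MM].
Proof.
move=> [k [c [g [Sg ->]]]] /msupp_sum_le /flatten_mapP[i _ /msupp_mul_divides[a ag ab]].
by exists (g i), a.
Qed.

Lemma in_lt_ideal_divides G f b :
  ideal_gen [set in_lt lt g | g in [set` G]]%classic f -> b \in msupp f ->
  exists g a, [/\ g \in G, lead_exponent lt g a & (a <= b)%MM].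
Proof.
move=> Gf /(msupp_ideal_gen Gf)[_ [a [[g Gg <-] /msupp_in_lt ga ab]]].
by exists g, a.
Qed.

Lemma divides_in_lt_ideal (S : set {mpoly K[n]}) g a b c :
  S g -> lead_exponent lt g a -> (a <= b)%MM ->
  ideal_gen [set in_lt lt g | g in S]%classic (c *: 'X_[b]).
Proof.
move=> Sg ga ab; have [_ _ idM] := ideal_gen_is_ideal [set in_lt lt g | g in S]%classic.
have -> : c *: 'X_[b] = ((c / g@_a) *: 'X_[b - a]) * in_lt lt g.
  rewrite (in_lt_lead ga) -scalerAl -scalerAr scalerA divfK ?lead_coeff_neq0 //.
  by rewrite -mpolyXD submK.
by apply/idM/mem_ideal_gen; exists g.
Qed.

(** One step of the division algorithm: the multiple of g has the same leading
    term as f, so the subtraction leaves only smaller monomials. *)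
Lemma cancel_lead f g a b : lead_exponent lt f b -> lead_exponent lt g a -> (a <= b)%MM ->
  forall c, c \in msupp (f - (f@_b / g@_a) *: 'X_[b - a] * g) -> lt c b.
Proof.
move=> fb ga ab c; set q := _ *: _ => c_in.
have q_c e : e \in msupp (q * g) -> (e == b) || lt e b.
  rewrite /q -scalerAl => /msuppZ_le; rewrite mulrC => e_in.
  move: e_in; rewrite (perm_mem (msuppMX _ _)) => /mapP[e' e'g ->].
  move: (submK ab); move: (b - a)%MM => m <-; rewrite ![(m + _)%MM]addmC.
  have /andP[_ /allP g_max] := ga; case/orP: (g_max e' e'g) => [/eqP ->|lt_e'].
    by rewrite eqxx.
  by case: lt_order => _ _ _ add _; rewrite add ?orbT.
have c_le : (c == b) || lt c b.
  have := msuppB_le c_in; rewrite mem_cat => /orP[cf|]; last exact: q_c.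
  by have /andP[_ /allP] := fb; apply.
case/orP: c_le => // /eqP cb; move: c_in; rewrite cb mcoeff_msupp mcoeffB.
rewrite /q -scalerAl mcoeffZ mulrC (_ : ('X_[b - a] * g)@_b = g@_a).
  by rewrite mulrC divfK ?subrr ?eqxx ?lead_coeff_neq0.
by move: (submK ab); move: (b - a)%MM => m <-; rewrite mulrC mcoeffMX.
Qed.

(** Divisibility of leading monomials yields the equality of initial ideals, as
    these are spanned by monomials.  Repeating [cancel_lead] reduces an element of I
    to 0 after finitely many steps, since leading exponents decrease for a
    well-founded order; hence I is generated by G. *)
Lemma groebner_criterion I G : is_ideal I -> (forall g, g \in G -> I g) ->
  (forall f b, I f -> lead_exponent lt f b ->
     exists g a, [/\ g \in G, lead_exponent lt g a & (a <= b)%MM]) ->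
  groebner_basis lt I G /\ ideal_gen [set` G]%classic = I.
Proof.
move=> idI GI divG; have idG := ideal_gen_is_ideal [set` G]%classic.
split; first split=> //.
  apply/seteqP; split; apply: ideal_gen_min.
  - exact: ideal_gen_is_ideal.
  - by move=> _ [g Gg <-]; apply: mem_ideal_gen; exists g => //; apply: GI.
  - exact: ideal_gen_is_ideal.
  - move=> _ [f If <-]; have [f0|f0] := eqVneq f 0.
      rewrite f0 in_lt0.
      by have [] := ideal_gen_is_ideal [set in_lt lt g | g in [set` G]]%classic.
    have [b fb] := exists_lead_exponent f0; rewrite (in_lt_lead fb).
    have [g [a [Gg ga ab]]] := divG _ _ If fb.
    exact: divides_in_lt_ideal Gg ga ab.
apply/seteqP; split; first exact: ideal_gen_min.
move=> f If; have [->|f0] := eqVneq f 0; first by case: idG.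
have [b fb] := exists_lead_exponent f0.
elim/(well_founded_ind (term_order_wf lt_order)): b => b IHb in f If f0 fb *.
have [g [a [Gg ga ab]]] := divG _ _ If fb.
set q := (f@_b / g@_a) *: 'X_[b - a]; pose f' := f - q * g.
have [_ IDD IM] := idI; have [G0 GD GM] := idG.
have -> : f = f' + q * g by rewrite subrK.
apply: (GD); last by apply/GM/mem_ideal_gen.
have [->//|f'0] := eqVneq f' 0.
have [b' f'b'] := exists_lead_exponent f'0.
apply: (IHb b') (f'b') => //.
  by apply: (cancel_lead fb ga ab); case/andP: f'b'.
by apply: IDD => //; rewrite -mulNr; apply/IM/GI.
Qed.

End LeadingExponents.

(** * Interior points of a full-dimensional cone *)
Section Weights.

Lemma wdegD (R : pzRingType) n (w : 'rV[R]_n) a b :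
  wdeg w (a + b)%MM = wdeg w a + wdeg w b.
Proof. by rewrite /wdeg -big_split; apply: eq_bigr => i _; rewrite mnmDE mulrnDr. Qed.

Lemma wdeg_linear (R : realType) n (t : R) (u w : 'rV[R]_n) a :
  wdeg (t *: u + w) a = t * wdeg u a + wdeg w a.
Proof.
rewrite /wdeg mulr_sumr -big_split; apply: eq_bigr => i _.
by rewrite !mxE mulrnDl mulrnAr.
Qed.

Lemma wdeg_intr (R : realType) n (u : 'rV[int]_n) a :
  wdeg (map_mx intr u : 'rV[R]_n) a = (wdeg u a)%:~R.
Proof. by rewrite /wdeg rmorph_sum; apply: eq_bigr => i _; rewrite mxE rmorphMn. Qed.

End Weights.

Section InteriorPoints.
Context {R : realType} {n k : nat}.
Variable A : 'M[R]_(n, k).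
Let C : set 'rV[R]_n := [set u | forall j, 0 <= (u *m A) 0 j]%classic.

(** A zero column of A imposes no condition on the cone, and no point can satisfy
    it strictly; hence the restriction to nonzero columns. *)
Definition strictly_inside (w : 'rV[R]_n) : Prop :=
  forall j, col j A != 0 -> 0 < (w *m A) 0 j.

Lemma col0_mulmx (u : 'rV[R]_n) j : col j A = 0 -> (u *m A) 0 j = 0.
Proof.
move=> /colP Aj; rewrite mxE big1 // => i _.
by have := Aj i; rewrite !mxE => ->; rewrite mulr0.
Qed.

(** The radius (1 + T)^-1 is small enough for every inequality at once: moving w by
    less than this changes the j-th inequality by at most (1 + T)^-1 * S j, and
    S j <= T * (w *m A) 0 j. *)
Lemma strictly_inside_relint w : strictly_inside w -> relint C w.
Proof.
move=> wA; pose S j := \sum_i `|A i j|.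
have S_ge0 j : 0 <= S j by apply: sumr_ge0.
have Cw : C w.
  by move=> j; have [/col0_mulmx ->//|/wA/ltW] := eqVneq (col j A) 0.
pose T := \sum_j S j / (w *m A) 0 j.
have T_ge j : S j / (w *m A) 0 j <= T.
  rewrite /T (bigD1 j) //= lerDl; apply: sumr_ge0 => l _.
  by rewrite divr_ge0.
have T_ge0 : 0 <= T by apply: sumr_ge0 => j _; rewrite divr_ge0.
have T1 : 0 < 1 + T by rewrite ltr_wpDr.
split=> //; exists (1 + T)^-1; first by rewrite invr_gt0.
move=> v _ vw j; have [/col0_mulmx ->//|/wA wj] := eqVneq (col j A) 0.
have -> : (v *m A) 0 j = (w *m A) 0 j + ((v - w) *m A) 0 j.
  by rewrite -[v in LHS](subrK w) addrC mulmxDl mxE.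
suff : `|((v - w) *m A) 0 j| <= (w *m A) 0 j by rewrite ler_norml => /andP[]; lra.
apply: (@le_trans _ _ ((1 + T)^-1 * S j)).
  rewrite mxE mulr_sumr; apply: le_trans (ler_norm_sum _ _ _) _.
  apply: ler_sum => i _; rewrite normrM ler_wpM2r // !mxE.
  by rewrite ltW //; apply: vw.
rewrite mulrC ler_pdivrMr // mulrC -ler_pdivrMr //.
by apply: le_trans (T_ge j) _; rewrite lerDr.
Qed.

(** If some nonzero column vanished on all of C it would vanish on the span of C,
    which is the whole space.  So each column is positive at some point of C, and the
    sum of these points is positive on all of them. *)
Lemma exists_strictly_inside : cone_dim C n -> exists w, strictly_inside w.
Proof.
move=> [B Bfree spanC].
have pos_at j : exists v, C v /\ (col j A != 0 -> 0 < (v *m A) 0 j).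
  apply: contrapT => none.
  have Aj0 : col j A != 0.
    apply/negP => /eqP Aj0; apply: none; exists 0; split; last by rewrite Aj0 eqxx.
    by move=> l; rewrite mul0mx mxE.
  have vanish v : C v -> (v *m A) 0 j = 0.
    move=> Cv; apply: contrapT => /eqP nz; apply: none; exists v.
    by split=> // _; rewrite lt_def nz Cv.
  case/eqP: Aj0; apply/colP => i; rewrite !mxE.
  have subB : ((delta_mx 0 i : 'rV_n) <= B)%MS by apply: submx_full; rewrite /row_full.
  have [l [D [CD /submxP[c ec]]]] := (spanC _).2 subB.
  have := congr1 (fun M : 'rV_n => (M *m A) 0 j) ec.
  rewrite -rowE mxE => ->; rewrite -mulmxA mxE big1 // => x _.
  have := vanish _ (CD x); rewrite -row_mul mxE => ->.
  by rewrite mulr0.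
have [v v_spec] := choice pos_at.
exists (\sum_j v j) => j Aj; rewrite mulmx_suml summxE (bigD1 j) //=.
have [_ /(_ Aj) vj] := v_spec j.
by rewrite ltr_wpDr // sumr_ge0 // => l _; have [+ _] := v_spec l; apply.
Qed.

Lemma strictly_insideD (t : R) u w :
  0 <= t -> C u -> strictly_inside w -> strictly_inside (t *: u + w).
Proof.
move=> t0 Cu wA j Aj; rewrite mulmxDl -scalemxAl mxE [X in 0 < X + _]mxE.
by rewrite ltr_wpDl ?wA // mulr_ge0.
Qed.

End InteriorPoints.

(** * Leading exponents of a reduced basis have minimal weight on the cone *)
Section WeightsOfReducedBasis.
Context {K : fieldType} {R : realType} {n : nat} {lt : rel 'X_{1..n}}.
Hypothesis lt_order : term_order lt.
Implicit Types (J : set {mpoly K[n]}) (G : seq {mpoly K[n]}) (g : {mpoly K[n]}).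

(** A leading exponent a' of some h in G dividing b is excluded twice: for h != g by
    reducedness, and for h = g because a divisor of b is at most b, whereas b is
    smaller than the leading exponent a. *)
Lemma reduced_tail_standard J G g a b f : reduced_groebner_basis lt J G ->
  g \in G -> lead_exponent lt g a -> b \in msupp g -> b != a ->
  in_lt_ideal lt J f -> b \notin msupp f.
Proof.
move=> [[_ <-] _ red] Gg ga bg ba Jf; apply/negP => bf.
have [h [a' [Gh ha' a'b]]] := in_lt_ideal_divides lt_order Jf bf.
have [hg|hg] := eqVneq h g.
  rewrite {}hg in ha'; rewrite -(lead_exponent_uniq lt_order ga ha') in a'b.
  have /andP[_ /allP/(_ b bg)] := ga; rewrite (negbTE ba) /= => lt_ba.
  have := term_order_divides lt_order a'b; rewrite eq_sym (negbTE ba) /=.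
  exact: term_order_antisym lt_ba.
apply: (red g b Gg bg); rewrite -[X in ideal_gen _ X]scale1r.
by apply: (divides_in_lt_ideal lt_order _ _ ha' a'b).
Qed.

Lemma exists_min_weight (w : 'rV[R]_n) (s : seq 'X_{1..n}) : s != [::] ->
  exists2 b, b \in s & all (fun c => wdeg w b <= wdeg w c) s.
Proof.
elim: s => // a s IHs _; have [->|/IHs[b bs /allP b_min]] := eqVneq s [::].
  by exists a; rewrite ?inE //= lexx.
have [ab|ba] := leP (wdeg w a) (wdeg w b).
  exists a; rewrite ?inE ?eqxx //= lexx; apply/allP => c cs.
  exact: le_trans ab (b_min c cs).
by exists b; rewrite ?inE ?bs ?orbT //= (ltW ba); apply/allP.
Qed.

Lemma mem_msupp_in_w (w : 'rV[R]_n) g b :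
  b \in msupp g -> all (fun c => wdeg w b <= wdeg w c) (msupp g) ->
  b \in msupp (in_w w g).
Proof.
move=> bg b_min; rewrite /in_w -big_filter.
rewrite (perm_mem (msupp_sumX _ _)) ?filter_uniq ?msupp_uniq ?mem_filter ?bg ?b_min //.
by move=> c; rewrite mem_filter mcoeff_msupp => /andP[].
Qed.

(** An exponent of g of least w-weight occurs in in_w(g), which belongs to the
    initial ideal of J; by [reduced_tail_standard] that exponent can only be a. *)
Lemma lead_min_weight J G g a (w : 'rV[R]_n) b : reduced_groebner_basis lt J G ->
  in_lt_ideal lt J = in_w_ideal w J ->
  g \in G -> lead_exponent lt g a -> b \in msupp g ->
  wdeg w a <= wdeg w b.
Proof.
move=> redG eqJ Gg ga bg.
have [c cg c_min] : exists2 c, c \in msupp g &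
    all (fun e => wdeg w c <= wdeg w e) (msupp g).
  by apply: exists_min_weight; case: (msupp g) bg.
have [<-|ca] := eqVneq c a; first by move/allP: c_min; apply.
have Jin : in_lt_ideal lt J (in_w w g).
  rewrite eqJ; apply: mem_ideal_gen; exists g => //.
  by have [[GJ _] _ _] := redG; apply: GJ.
have := reduced_tail_standard redG Gg ga cg ca Jin.
by rewrite mem_msupp_in_w.
Qed.

(** The weights t *: u + w with t >= 0 and w strictly inside C are interior to C, so
    the inequality holds for each of them; for large t it is dominated by its
    u-part, which must therefore be nonnegative. *)
Lemma lead_min_weight_cone J G (C : set 'rV[R]_n) :
  polyhedral_cone C -> cone_dim C n -> compatible J lt C ->
  reduced_groebner_basis lt J G ->
  forall u g a b, C u -> g \in G -> lead_exponent lt g a -> b \in msupp g ->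
  wdeg u a <= wdeg u b.
Proof.
move=> [k [A ->]] dimC compC redG u g a b Cu Gg ga bg.
have [w wA] := exists_strictly_inside dimC.
have le_t t : 0 <= t -> wdeg (t *: u + w) a <= wdeg (t *: u + w) b.
  move=> t0; apply: (lead_min_weight redG _ Gg ga bg); apply: compC.
  exact/strictly_inside_relint/strictly_insideD.
rewrite leNgt; apply/negP => lt_ba.
have := le_t 0; have := le_t ((wdeg w b - wdeg w a) / (wdeg u a - wdeg u b) + 1).
rewrite !wdeg_linear; set x := wdeg u a in lt_ba *; set y := wdeg u b in lt_ba *.
set p := wdeg w a; set q := wdeg w b => le_T /(_ (lexx _)) le_0.
have xy : 0 < x - y by rewrite subr_gt0.
have pq : p <= q by lra.
(* At this t the two weights of exponents a and b tie; one unit further the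
   inequality is reversed if wdeg u b < wdeg u a. *)
pose t := (q - p) / (x - y); 
have t0 : 0 <= t by apply: divr_ge0; rewrite ?(ltW xy) // subr_ge0.
have t_xy : t * (x - y) = q - p by rewrite divfK // gt_eqF.
have := le_T (addr_ge0 t0 ler01); rewrite -/t => {}le_T. nra.
Qed.

End WeightsOfReducedBasis.

(** * Lifts and the grading by the rays *)
Section Lifting.
Context {K : fieldType} {m n : nat} {lt : rel 'X_{1..n}}.
Hypothesis lt_order : term_order lt.
Variable r : 'M[int]_(m, n).
Implicit Types (f g : {mpoly K[n]}) (h : {mpoly K[m + n]}) (c e : 'X_{1..(m + n)}).
Implicit Types (a b : 'X_{1..n}) (delta : 'rV[int]_m).

Lemma xpart_mnm_xt a (l : 'X_{1..m}) : xpart (mnm_xt a l) = a.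
Proof. by apply/mnmP => j; rewrite !mnmE (unsplitK (inr j)). Qed.

Lemma tpart_mnm_xt a (l : 'X_{1..m}) : tpart (mnm_xt a l) = l.
Proof. by apply/mnmP => i; rewrite !mnmE (unsplitK (inl i)). Qed.

Lemma mnm_xtK c : mnm_xt (xpart c) (tpart c) = c.
Proof.
by apply/mnmP => k; rewrite mnmE -{2}(splitK k); case: (split k) => j; rewrite mnmE.
Qed.

Lemma xpartD c e : xpart (c + e)%MM = (xpart c + xpart e)%MM.
Proof. by apply/mnmP => j; rewrite !(mnmE, mnmDE). Qed.

Lemma tpartD c e : tpart (c + e)%MM = (tpart c + tpart e)%MM.
Proof. by apply/mnmP => j; rewrite !(mnmE, mnmDE). Qed.

(** The grading of K[t][x] in which the lift of f is homogeneous of degree mu(f): x_j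
    has degree the j-th column of r and t_i has degree minus the i-th unit vector. *)
Definition tdeg c : 'rV[int]_m :=
  \row_i (wdeg (row i r) (xpart c) - (tpart c i)%:Z).

Lemma tdegD c e : tdeg (c + e)%MM = tdeg c + tdeg e.
Proof.
apply/rowP => i; rewrite !mxE xpartD tpartD wdegD mnmDE PoszD.
by rewrite opprD addrACA.
Qed.

(** This is why setting t = 1 is injective on homogeneous components. *)
Lemma tdeg_inj c e : tdeg c = tdeg e -> xpart c = xpart e -> c = e.
Proof.
move=> /rowP ce xce; rewrite -(mnm_xtK c) -(mnm_xtK e) xce; congr mnm_xt.
apply/mnmP => i; have := ce i; rewrite !mxE xce => /addrI/oppr_inj.
by case.
Qed.

Lemma mu_le f i a : a \in msupp f -> mu r f i <= wdeg (row i r) a.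
Proof. by move=> af; apply: ge_bigmin_seq. Qed.

Lemma mu_eq f i a : a \in msupp f ->
  (forall b, b \in msupp f -> wdeg (row i r) a <= wdeg (row i r) b) ->
  mu r f i = wdeg (row i r) a.
Proof.
move=> af a_min; apply: le_anti; rewrite mu_le //=.
rewrite /mu big_seq; apply: (big_ind (fun x => wdeg (row i r) a <= x)) => //.
- by apply: a_min; case: (msupp f) af => // b s _; rewrite inE eqxx.
- by move=> x y ax ay; rewrite le_min ax.
Qed.

Lemma tdeg_lift f a : a \in msupp f ->
  tdeg (mnm_xt a (t_exponent r f a)) = \row_i mu r f i.
Proof.
move=> af; apply/rowP => i; rewrite !mxE xpart_mnm_xt tpart_mnm_xt mnmE.
by rewrite gez0_abs ?subr_ge0 ?mu_le // opprB addrC subrK.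
Qed.

Lemma msupp_lift f :
  perm_eq (msupp (lift_poly r f))
          [seq mnm_xt a (t_exponent r f a) | a <- msupp f].
Proof.
have -> : lift_poly r f =
    \sum_(c <- [seq mnm_xt a (t_exponent r f a) | a <- msupp f])
       f@_(xpart c) *: 'X_[c].
  by rewrite big_map; apply: eq_bigr => a _; rewrite xpart_mnm_xt.
apply: msupp_sumX.
  rewrite map_inj_uniq ?msupp_uniq // => a b /(congr1 xpart).
  by rewrite !xpart_mnm_xt.
by move=> _ /mapP[a af ->]; rewrite xpart_mnm_xt -mcoeff_msupp.
Qed.

Lemma lead_exponent_lift f a : lead_exponent lt f a ->
  lead_exponent (ll lt) (lift_poly r f) (mnm_xt a (t_exponent r f a)).
Proof.
case/andP=> af /allP a_max; apply/andP; split.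
  rewrite (perm_mem (msupp_lift f)).
  exact: (map_f (fun b => mnm_xt b (t_exponent r f b))).
apply/allP => c; rewrite (perm_mem (msupp_lift f)) => /mapP[b bf ->].
case/orP: (a_max b bf) => [/eqP ->|ba]; first by rewrite eqxx.
by rewrite /ll !xpart_mnm_xt ba orbT.
Qed.

(** The value at t = 1 of the homogeneous component of degree delta of h. *)
Definition slice delta h : {mpoly K[n]} :=
  \sum_(c <- msupp h | tdeg c == delta) h@_c *: 'X_[xpart c].

Lemma mcoeff_slice h c : (slice (tdeg c) h)@_(xpart c) = h@_c.
Proof.
rewrite /slice raddf_sum /= big_mkcond /=.
have [ch|ch] := boolP (c \in msupp h).
  rewrite (bigD1_seq c) ?msupp_uniq //= eqxx mcoeffZ mcoeffX eqxx mulr1.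
  rewrite big1 ?addr0 // => e ec; case: eqP => // dec.
  rewrite mcoeffZ mcoeffX; case: eqP => [xec|_]; last by rewrite mulr0.
  by case/eqP: ec; apply: tdeg_inj.
rewrite (memN_msupp_eq0 ch) big_seq big1 // => e eh; case: eqP => // dec.
rewrite mcoeffZ mcoeffX; case: eqP => [xec|_]; last by rewrite mulr0.
by move: ch; rewrite -(tdeg_inj dec xec) eh.
Qed.

Lemma msupp_slice delta h a : a \in msupp (slice delta h) ->
  exists c, [/\ c \in msupp h, tdeg c = delta & xpart c = a].
Proof.
rewrite /slice -big_filter.
move=> /msupp_sum_le /flatten_mapP[c]; rewrite filter_predT mem_filter.
move=> /andP[/eqP dc ch] /msuppZ_le; rewrite msuppX inE => /eqP ->.
by exists c.
Qed.

(** Coefficientwise: the coefficient of x^a in the slice is the coefficient in h of the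
    only monomial of degree delta above x^a, or 0 if there is none. *)
Lemma slice_is_linear delta : linear (slice delta).
Proof.
move=> k h1 h2; apply/mpolyP => a.
have [[c [<- <-]]|none] := pselect (exists c, tdeg c = delta /\ xpart c = a).
  by rewrite mcoeffD mcoeffZ !mcoeff_slice mcoeffD mcoeffZ.
have out h : (slice delta h)@_a = 0.
  apply/eqP; rewrite mcoeff_eq0; apply/negP => /msupp_slice[c [_ dc xc]].
  by apply: none; exists c.
by rewrite mcoeffD mcoeffZ !out mulr0 addr0.
Qed.

HB.instance Definition _ delta :=
  GRing.isLinear.Build K {mpoly K[m + n]} {mpoly K[n]} _ (slice delta)
    (slice_is_linear delta).

Lemma sliceX delta c :
  slice delta 'X_[c] = if tdeg c == delta then 'X_[xpart c] else 0.
Proof. by rewrite /slice msuppX big_mkcond big_seq1 mcoeffX eqxx scale1r. Qed.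

(** The product is homogeneous, and setting t = 1 turns the lift of f back into f. *)
Lemma slice_mulX_lift delta c f :
  slice delta ('X_[c] * lift_poly r f) =
  if tdeg c + \row_i mu r f i == delta then 'X_[xpart c] * f else 0.
Proof.
rewrite /lift_poly mulr_sumr raddf_sum /=.
transitivity (\sum_(a <- msupp f) if tdeg c + \row_i mu r f i == delta
                then 'X_[xpart c] * (f@_a *: 'X_[a]) else 0).
  apply: eq_big_seq => a af; rewrite -scalerAr linearZ /= -mpolyXD sliceX.
  rewrite tdegD tdeg_lift // xpartD xpart_mnm_xt.
  by case: ifP => _; rewrite ?scaler0 // mpolyXD scalerAr.
case: ifP => _; last by rewrite big1.
by rewrite -mulr_sumr -mpolyE.
Qed.

(** The lifted ideal is spanned over K by monomial multiples of lifts, whose slices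
    are monomial multiples of elements of J, or 0. *)
Lemma slice_lifted_ideal (J : set {mpoly K[n]}) delta h :
  is_ideal J -> lifted_ideal r J h -> J (slice delta h).
Proof.
move=> idJ [k [c [g [Jg ->]]]]; have [J0 _ JM] := idJ.
rewrite raddf_sum; apply: is_ideal_sum => // i _.
have [f [Jf _] <-] := Jg i.
rewrite [c i]mpolyE mulr_suml raddf_sum; apply: is_ideal_sum => // e _ /=.
rewrite -scalerAl linearZ /= slice_mulX_lift -mul_mpolyC; apply: (JM).
by case: ifP => _ //; apply: JM.
Qed.

(** << compares the x-parts first, and every exponent of the slice is the x-part of
    an exponent of h. *)
Lemma lead_exponent_slice h c : lead_exponent (ll lt) h c ->
  lead_exponent lt (slice (tdeg c) h) (xpart c).
Proof.
case/andP=> ch /allP c_max; apply/andP; split.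
  by rewrite mcoeff_msupp mcoeff_slice -mcoeff_msupp.
apply/allP => a /msupp_slice[e [eh dec <-]].
case/orP: (c_max e eh) => [/eqP ->|]; first by rewrite eqxx.
by rewrite /ll => /orP[->|/andP[-> _]]; rewrite ?orbT.
Qed.

(** The minimality hypothesis makes the t-exponent of the leading monomial of each
    lifted g vanish; it is what allows that monomial to divide the one of h, whatever
    the power of t in the latter. *)
Lemma lift_groebner_basis (J : set {mpoly K[n]}) (G : seq {mpoly K[n]}) :
  is_ideal J -> groebner_basis lt J G -> (forall g, g \in G -> g != 0) ->
  (forall i g a b, g \in G -> lead_exponent lt g a -> b \in msupp g ->
     wdeg (row i r) a <= wdeg (row i r) b) ->
  groebner_basis (ll lt) (lifted_ideal r J) (map (lift_poly r) G) /\
  ideal_gen [set` map (lift_poly r) G]%classic = lifted_ideal r J.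
Proof.
move=> idJ [GJ eqJ] G0 G_min.
apply: groebner_criterion; first exact: ll_term_order.
- exact: ideal_gen_is_ideal.
- move=> _ /mapP[g Gg ->]; apply: mem_ideal_gen; exists g => //=.
  by split; [apply: GJ | apply: G0].
move=> h c Jh hc; have fa := lead_exponent_slice hc.
set f := slice _ h in fa.
have Jf : in_lt_ideal lt J (in_lt lt f).
  by apply: mem_ideal_gen; exists f => //; apply: slice_lifted_ideal.
have cf : xpart c \in msupp (in_lt lt f).
  by rewrite (in_lt_lead lt_order fa) msuppMCX ?inE // (lead_coeff_neq0 fa).
rewrite -eqJ in Jf.
have [g [a [Gg ga ac]]] := in_lt_ideal_divides lt_order Jf cf.
exists (lift_poly r g), (mnm_xt a (t_exponent r g a)); split.
- exact: map_f.
- exact: lead_exponent_lift.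
rewrite -(mnm_xtK c); apply/mnm_lepP => k.
rewrite -(splitK k); case: (split k) => [i|j] /=; last first.
  rewrite !mnmE (unsplitK (inr j)); exact: (mnm_lepP ac).
have /andP[ag _] := ga.
by rewrite !mnmE (unsplitK (inl i)) mnmE (mu_eq ag (fun b => G_min i g a b Gg ga)) subrr.
Qed.

End Lifting.

Unset Implicit Arguments.

Theorem proposition3p9 (K : closedFieldType) (R : realType) (n m : nat)
    (d : 'rV[int]_n) (J : set {mpoly K[n]})
    (Sigma : set (set 'rV[R]_n)) (C : set 'rV[R]_n)
    (lt : rel 'X_{1..n}) (G : seq {mpoly K[n]}) (r : 'M[int]_(m, n)) :
  (forall i, 0 < d 0 i) ->
  homogeneous_ideal d J ->
  groebner_fan J Sigma ->
  maximal_cone Sigma C ->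
  term_order lt ->
  compatible J lt C ->
  reduced_groebner_basis lt J G ->
  represent_rays (lineality J) C r ->
  groebner_basis (ll lt) (lifted_ideal r J) (map (lift_poly r) G) /\
  ideal_gen [set` map (lift_poly r) G]%classic = lifted_ideal r J.
Proof.
move=> _ [S _ JS] [[_ polySigma _ _ _] _] [SigmaC dimC] lt_order compC redG [Cr _].
have [gbG monicG _] := redG; apply: lift_groebner_basis => //.
- by rewrite JS; apply: ideal_gen_is_ideal.
- move=> g /monicG[a in_g]; apply/eqP => g0.
  have := congr1 (mcoeff a) in_g; rewrite g0.
  by rewrite in_lt0 mcoeff0 mcoeffX eqxx => /esym/eqP; rewrite oner_eq0.
move=> i g a b Gg ga bg; rewrite -(ler_int R) -!wdeg_intr.
exact: (lead_min_weight_cone lt_order (polySigma _ SigmaC) dimC compC redG (Cr i) Gg ga bg).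
Qed.
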